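(* Let $d\ge3$ be odd. Then $$\sum_{\mathcal{D}}\frac{1}{|\mathrm{Aut}(\mathcal{D})|}=\frac{2\,(d-1)!}{d\,(d+1)},$$ where the sum runs over the isomorphism classes of extremal dessins of degree $d$, i.e. those with passport $\langle(d),(d),(d)\rangle$. For $d$ even the sum is empty.
   Context: A dessin of degree $d$ is (equivalently) an isomorphism class of pairs $(X,t)$ with $X$ a smooth projective connected curve over $\mathbb{C}$ and $t\colon X\to\mathbb{P}^1$ a morphism of degree $d$ branched only over $\{0,1,\infty\}$ (isomorphisms being isomorphisms of curves commuting with the maps to $\mathbb{P}^1$); equivalently a triple $(\sigma_0,\sigma_1,\sigma_\infty)\in\mathfrak{S}_d^3$ with $\sigma_0\sigma_1\sigma_\infty=1$ and $\langle\sigma_0,\sigma_1\rangle$ transitive, up to simultaneous conjugation in $\mathfrak{S}_d$. The passport is the triple of cycle types of $(\sigma_0,\sigma_1,\sigma_\infty)$; so passport $\langle(d),(d),(d)\rangle$ means that $\sigma_0,\sigma_1,\sigma_\infty$ are all $d$-cycles. $\mathrm{Aut}(\mathcal{D})$ is the automorphism group of the Belyi map, equal to the centralizer of $\langle\sigma_0,\sigma_1\rangle$ in $\mathfrak{S}_d$. *)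

(* Defs.v *)
From HB Require Import structures.
From mathcomp Require Import all_boot all_order all_algebra all_fingroup.
Set Implicit Arguments.
Unset Strict Implicit.
Unset Printing Implicit Defensive.

(* Sizes of the cycles, fixed points included, in nonincreasing order. *)
Definition cycle_type d (s : 'S_d) : seq nat :=
  sort geq [seq #|pred_of_set C| | C in porbits s].

(* MathComp composes permutations from left to right.  Inverting all three
   entries exchanges this convention with the right-to-left one, and preserves
   passports, conjugacy of triples and centralizers. *)
Definition is_monodromy d (t : 'S_d * 'S_d * 'S_d) : bool :=
  let: (s0, s1, soo) := t in
  (s0 * s1 * soo == 1)%g &&
  [transitive <<[set s0; s1]>>%g, on [set: 'I_d] | 'P].

Record monodromy d := Monodromy {
  monodromy_val :> 'S_d * 'S_d * 'S_d;
  _ : is_monodromy monodromy_val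
}.

HB.instance Definition _ d := [isSub for @monodromy_val d].
HB.instance Definition _ d := [Finite of monodromy d by <:].

Definition sigma0 d (t : monodromy d) : 'S_d := (monodromy_val t).1.1.
Definition sigma1 d (t : monodromy d) : 'S_d := (monodromy_val t).1.2.
Definition sigmaoo d (t : monodromy d) : 'S_d := (monodromy_val t).2.

Definition simconj d : rel (monodromy d) := fun t u =>
  [exists g : 'S_d, [&& sigma0 u == (sigma0 t ^ g)%g,
                        sigma1 u == (sigma1 t ^ g)%g &
                        sigmaoo u == (sigmaoo t ^ g)%g]].

Lemma simconjP d (t u : monodromy d) :
  reflect (exists g : 'S_d, [/\ sigma0 u = (sigma0 t ^ g)%g,
                                sigma1 u = (sigma1 t ^ g)%g &
                                sigmaoo u = (sigmaoo t ^ g)%g])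
          (simconj t u).
Proof.
apply: (iffP existsP) => [[g /and3P[/eqP ? /eqP ? /eqP ?]]|[g [e0 e1 eoo]]].
  by exists g.
by exists g; rewrite e0 e1 eoo !eqxx.
Qed.

Lemma simconj_refl d : reflexive (@simconj d).
Proof. by move=> t; apply/simconjP; exists 1%g; rewrite !conjg1. Qed.

Lemma simconj_sym d : symmetric (@simconj d).
Proof.
suff sub t u : @simconj d t u -> simconj u t.
  by move=> t u; apply/idP/idP; apply: sub.
move=> /simconjP[g [e0 e1 eoo]]; apply/simconjP; exists g^-1%g.
by rewrite e0 e1 eoo !conjgK.
Qed.

Lemma simconj_trans d : transitive (@simconj d).
Proof.
move=> u t v /simconjP[g [e0 e1 eoo]] /simconjP[h [f0 f1 foo]].
by apply/simconjP; exists (g * h)%g; rewrite f0 f1 foo e0 e1 eoo !conjgM.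
Qed.

Canonical simconj_equiv d := EquivRel (@simconj d)
  (@simconj_refl d) (@simconj_sym d) (@simconj_trans d).

(* Isomorphism classes: monodromy triples up to simultaneous conjugation. *)
Definition dessin d := {eq_quot (simconj_equiv d)}%qT.
HB.instance Definition _ d := Countable.on (dessin d).
HB.instance Definition _ d := EqQuotient.on (dessin d).
HB.instance Definition _ d : isFinite (dessin d) :=
  CanIsFinite (@reprK _ (dessin d)).

(* The passport and the automorphism group of a dessin are those of a chosen
   representative; [passport_pi] and [card_Aut_pi] show that the passport and
   the order of the automorphism group do not depend on that choice. *)
Definition monodromy_passport d (t : monodromy d) : seq nat * seq nat * seq nat :=
  (cycle_type (sigma0 t), cycle_type (sigma1 t), cycle_type (sigmaoo t)).

Definition passport d (D : dessin d) := monodromy_passport (generic_quotient.repr D).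

Definition monodromy_Aut d (t : monodromy d) : {set 'S_d} :=
  'C(<<[set sigma0 t; sigma1 t]>>)%g.

Definition dessin_Aut d (D : dessin d) : {set 'S_d} := monodromy_Aut (generic_quotient.repr D).

Definition extremal d (D : dessin d) : bool :=
  passport D == ([:: d], [:: d], [:: d]).

Lemma porbitJ d (s g : 'S_d) (x : 'I_d) :
  porbit (s ^ g)%g (g x) = [set g y | y in porbit s x].
Proof.
apply/setP => z; apply/porbitP/imsetP => [[i ->]|[y /porbitP[i ->] ->]].
  exists ((s ^+ i)%g x); first exact: mem_porbit.
  by rewrite -conjXg permJ.
by exists i; rewrite -conjXg permJ.
Qed.

Lemma cycle_typeJ d (s g : 'S_d) : cycle_type (s ^ g)%g = cycle_type s.
Proof.
pose im (C : {set 'I_d}) := [set g y | y in C].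
have im_inj : injective im by apply: imset_inj; apply: perm_inj.
have orbJ : porbits (s ^ g)%g = im @: porbits s.
  apply/setP => C; apply/imsetP/imsetP => [[x _ ->]|[_ /imsetP[x _ ->] ->]].
    exists (porbit s (g^-1 x)%g); first exact: imset_f.
    by rewrite /im -porbitJ permKV.
  by exists (g x); rewrite // porbitJ.
have geq_trans : transitive geq by move=> m n p /= ? ?; apply: leq_trans; eauto.
have geq_anti : antisymmetric geq.
  by move=> m n /andP[? ?]; apply/eqP; rewrite eqn_leq; apply/andP.
have geq_total : total geq by move=> m n; apply: leq_total.
apply/perm_sortP => //; rewrite orbJ /image_mem.
have enumJ : perm_eq (enum (im @: porbits s)) (map im (enum (porbits s))).
  apply: uniq_perm; rewrite ?enum_uniq ?(map_inj_uniq im_inj) ?enum_uniq // => C.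
  rewrite mem_enum; apply/imsetP/mapP => -[B sB ->]; exists B => //.
    by rewrite mem_enum.
  by rewrite mem_enum in sB.
rewrite (perm_trans (perm_map _ enumJ)) // -map_comp.
rewrite (eq_map (g := fun C : {set 'I_d} => #|C|)) // => C /=.
by rewrite card_imset //; apply: perm_inj.
Qed.

Lemma simconj_repr_pi d (t : monodromy d) :
  simconj t (generic_quotient.repr (\pi_(dessin d)%qT t)).
Proof.
rewrite -[simconj _ _]/(simconj_equiv d _ _).
by apply/(eqquotP (dessin d)); rewrite reprK.
Qed.

Lemma passport_pi d (t : monodromy d) :
  passport (\pi_(dessin d)%qT t) = monodromy_passport t.
Proof.
have /simconjP[g [e0 e1 eoo]] := simconj_repr_pi t.
by rewrite /passport /monodromy_passport e0 e1 eoo !cycle_typeJ.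
Qed.

Lemma card_Aut_pi d (t : monodromy d) :
  #|dessin_Aut (\pi_(dessin d)%qT t)| = #|monodromy_Aut t|.
Proof.
have /simconjP[g [e0 e1 _]] := simconj_repr_pi t.
rewrite /dessin_Aut /monodromy_Aut e0 e1.
by rewrite -!conjg_set1 -conjUg genJ centJ cardJg.
Qed.

(* Main.v *)
Require Import Defs.
From HB Require Import structures.
From mathcomp Require Import all_boot all_order all_algebra all_fingroup.
From mathcomp Require Import zify ring.
Set Implicit Arguments.
Unset Strict Implicit.
Unset Printing Implicit Defensive.

(* By orbit-stabilizer the mass of the extremal dessins is 1/d! times the number
   of pairs (s, a) of d-cycles such that s a is a d-cycle.  For a permutation g,
   the sum of (-1)^|S| sgn(g|S) |S| over the g-stable sets S is -d if g is a
   d-cycle and 0 otherwise: (-1)^|S| sgn(g|S) is (-1) to the number of cycles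
   of g in S, and toggling a cycle that avoids a chosen point flips it.  (This
   is the derivative at u = 1 of det(1 - u g), an alternating sum of characters
   of exterior powers.)  Apply it to g = c a with c a fixed d-cycle, and sum
   over all d-cycles a.  For a given proper nonempty S,
   - if c S misses at least two points x, y of S, conjugating a by the
     transposition (x y) flips sgn(c a|S), so that S contributes nothing;
   - otherwise S is one of the d arcs of c of size j = |S|, the sign is always
     1, and (j - 1)! (d - j - 1)! cycles a map c S back to S.
   For d odd the number of a is therefore
     (d - 1)! - sum_(1 <= j < d) (-1)^j j! (d - 1 - j)!,
   which telescopes to 2 (d - 1)! / (d + 1). *)

Import GRing.Theory Num.Theory.

(** * Signs on stable sets and the signed identity for one permutation *)

Section FullCycles.

Variable T : finType.
Implicit Types (a c g : {perm T}) (S B : {set T}) (x y : T).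

Definition full_cycle g := #|porbits g| == 1%N.

Lemma full_cycle_porbit g x : full_cycle g -> porbit g x = setT.
Proof.
move=> /cards1P[C orbC]; have orbE y : porbit g y = C.
  by apply/set1P; rewrite -orbC imset_f.
by apply/setP=> y; rewrite inE orbE -(orbE y) porbit_id.
Qed.

Lemma full_cycle_of_porbit g x : porbit g x = setT -> full_cycle g.
Proof.
move=> gx; apply/cards1P; exists setT; apply/setP=> C; rewrite inE.
apply/imsetP/eqP=> [[y _ ->]|->]; last by exists x.
by apply/eqP; rewrite -gx eq_porbit_mem gx inE.
Qed.

Lemma full_cycleJ g a : full_cycle (g ^ a)%g = full_cycle g.
Proof.
suff sub h b : full_cycle h -> full_cycle (h ^ b)%g.
  by apply/idP/idP=> [/sub-/(_ a^-1%g)|/sub]; rewrite ?conjgK.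
move=> /[dup]/cards1P[C orbC] fh.
have /imsetP[x _ _] : C \in porbits h by rewrite orbC set11.
apply: (@full_cycle_of_porbit _ (b x)); apply/setP=> y; rewrite inE.
have /porbitP[i hy] : (b^-1)%g y \in porbit h x.
  by rewrite full_cycle_porbit ?inE.
by apply/porbitP; exists i; rewrite -conjXg permJ -hy permKV.
Qed.

Lemma full_cycleV g : full_cycle g^-1%g = full_cycle g.
Proof. by rewrite /full_cycle porbitsV. Qed.

Lemma odd_full_cycle g : full_cycle g -> odd_perm g = ~~ odd #|T|.
Proof. by move=> /eqP gT; rewrite /odd_perm gT addbT. Qed.

Lemma astabs_permE g S : (g \in 'N(S | 'P))%g = (g @: S == S).
Proof.
apply/astabsP/eqP=> [gS|gS x].
  apply/eqP; rewrite eqEcard card_imset ?leqnn ?andbT; last exact: perm_inj.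
  by apply/subsetP=> _ /imsetP[x Sx ->]; rewrite -[g x]/('P%act x g) gS.
by rewrite -{1}gS /= /aperm mem_imset //; apply: perm_inj.
Qed.

Lemma astabs_permP g S : (forall x, x \in S -> g x \in S) -> g \in 'N(S | 'P)%g.
Proof.
move=> gS; rewrite astabs_permE eqEcard card_imset ?leqnn ?andbT; last exact: perm_inj.
by apply/subsetP=> _ /imsetP[x Sx ->]; apply: gS.
Qed.

Lemma astabs_perm_act g S x : g \in 'N(S | 'P)%g -> (g x \in S) = (x \in S).
Proof. by move=> gS; rewrite -[g x]/('P%act x g) astabs_act. Qed.

Lemma astabs_porbit g x : g \in 'N(porbit g x | 'P)%g.
Proof.
apply: astabs_permP=> y /porbitP[i ->].
by rewrite -permM -expgSr mem_porbit.
Qed.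

Lemma porbit_sub_astabs g S x : g \in 'N(S | 'P)%g -> x \in S -> porbit g x \subset S.
Proof.
move=> gS Sx; apply/subsetP=> _ /porbitP[i ->].
by rewrite astabs_perm_act // groupX.
Qed.

Lemma full_cycle_stable g S : full_cycle g -> g \in 'N(S | 'P)%g ->
  S = set0 \/ S = setT.
Proof.
move=> fg gS; have [->|[x Sx]] := set_0Vmem S; [by left | right].
by apply/eqP; rewrite -subTset -(full_cycle_porbit x fg) porbit_sub_astabs.
Qed.

(** [restr_perm] fixes every point outside S, so the parity of g on S is read off from a permutation
    of T. *)
Definition restr_sgn S g : int := (-1) ^+ odd_perm (restr_perm S g).

Lemma restr_sgnM S :
  {in 'N(S | 'P)%g &, {morph restr_sgn S : a g / (a * g)%g >-> (a * g)%R}}.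
Proof. by move=> a g aS gS; rewrite /restr_sgn morphM // odd_permM signr_addb. Qed.

Lemma restr_sgnT g : restr_sgn setT g = ((-1) ^+ odd_perm g)%R.
Proof.
rewrite /restr_sgn; suff -> : restr_perm setT g = g by [].
have gT : g \in 'N(setT | 'P)%g by apply: astabs_permP=> x; rewrite !inE.
by apply/permP=> x; rewrite restr_permE // in_setT.
Qed.

Lemma restr_sgn1 x g : restr_sgn [set x] g = 1%R.
Proof.
rewrite /restr_sgn; suff -> : restr_perm [set x] g = 1%g by rewrite odd_perm1.
by apply: perm_on_id (restr_perm_on _ _) _; rewrite cards1.
Qed.

Lemma eq_in_restr_perm S a g : a \in 'N(S | 'P)%g -> g \in 'N(S | 'P)%g ->
  {in S, a =1 g} -> restr_perm S a = restr_perm S g.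
Proof.
move=> aS gS ag; apply/permP=> x; have [Sx|Sx] := boolP (x \in S).
  by rewrite !restr_permE ?ag.
by rewrite !(out_perm (restr_perm_on _ _)).
Qed.

Lemma restr_sgn_tperm S x y : x != y -> x \in S -> y \in S ->
  restr_sgn S (tperm x y) = (-1)%R.
Proof.
move=> xy Sx Sy; rewrite /restr_sgn.
suff -> : restr_perm S (tperm x y) = tperm x y by rewrite odd_tperm xy.
have tS : tperm x y \in 'N(S | 'P)%g.
  by apply: astabs_permP=> z Sz; case: tpermP.
apply/permP=> z; have [Sz|Sz] := boolP (z \in S); first by rewrite restr_permE.
rewrite (out_perm (restr_perm_on _ _)) // tpermD //.
  by apply: contraNneq Sz => <-.
by apply: contraNneq Sz => <-.
Qed.

(** The restriction has the orbit as one cycle and fixes all other points; [odd_perm] compares the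
    resulting number of cycles with #|T| modulo 2. *)
Lemma restr_sgn_porbit g x :
  restr_sgn (porbit g x) g = (- (-1) ^+ #|porbit g x|)%R.
Proof.
set C := porbit g x; set h := restr_perm C g.
have gC : g \in 'N(C | 'P)%g := astabs_porbit g x.
have hX i z : z \in C -> (h ^+ i)%g z = (g ^+ i)%g z.
  by move=> Cz; rewrite -morphX // restr_permE // groupX.
have hC y : y \in C -> porbit h y = C.
  move=> Cy; have Cx : x \in C := porbit_id g x.
  have <- : porbit g y = C by apply/eqP; rewrite eq_porbit_mem.
  by apply/setP=> z; apply/porbitP/porbitP=> -[i ->]; exists i; rewrite hX.
have hD y : y \notin C -> porbit h y = [set y].
  move=> Cy; have hy : h y = y by rewrite (out_perm (restr_perm_on _ _)).
  apply/setP=> z; rewrite inE; apply/porbitP/eqP=> [[i ->]|->].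
    by elim: i => [|i IH]; rewrite ?perm1 // expgSr permM IH.
  by exists 0%N; rewrite perm1.
have orbh : porbits h = C |: [set [set y] | y in ~: C].
  apply/setP=> B; rewrite in_setU1; apply/imsetP/predU1P=> [[y _ ->]|].
    have [Cy|Cy] := boolP (y \in C); [by left; rewrite hC|right].
    by rewrite hD //; apply: imset_f; rewrite inE.
  case=> [->|/imsetP[y Cy ->]]; first by exists x; rewrite ?(hC _ (porbit_id g x)).
  by rewrite inE in Cy; exists y; rewrite ?hD.
have card_h : #|porbits h| = (#|~: C|).+1.
  rewrite orbh cardsU1 card_imset; last exact: set1_inj.
  suff -> : C \notin [set [set y] | y in ~: C] by [].
  apply/imsetP=> -[y Cy eC]; have := set11 y.
  by rewrite -eC; apply/negP; rewrite -in_setC.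
rewrite /restr_sgn -/h /odd_perm card_h /= -(cardsC C) oddD.
rewrite addbN -addbA addbb addbF; case: odd (signr_odd int #|C|) => /= <-.
all: by rewrite ?expr0 ?expr1 ?opprK.
Qed.

Lemma restr_sgnU S B g : g \in 'N(S | 'P)%g -> g \in 'N(B | 'P)%g ->
  [disjoint S & B] -> restr_sgn (S :|: B) g = (restr_sgn S g * restr_sgn B g)%R.
Proof.
move=> gS gB dSB; rewrite /restr_sgn -signr_addb -odd_permM.
congr (_ ^+ odd_perm _)%R.
have gU : g \in 'N(S :|: B | 'P)%g.
  by apply: astabs_permP => x; rewrite !inE !astabs_perm_act.
apply/permP=> x; rewrite permM.
have [Sx|Sx] := boolP (x \in S).
  rewrite (restr_permE gS Sx) (restr_permE gU) ?inE ?Sx //.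
  rewrite (out_perm (restr_perm_on _ _)) //.
  by rewrite astabs_perm_act // (disjointFr dSB).
rewrite [restr_perm S g x](out_perm (restr_perm_on _ _)) //.
have [Bx|Bx] := boolP (x \in B); last first.
  by rewrite !(out_perm (restr_perm_on _ _)) // inE negb_or Sx.
by rewrite (restr_permE gB) // (restr_permE gU) // inE Bx orbT.
Qed.

(** Since #|S| counts the points of S, the sums can be exchanged: for each x the weights of the
    stable sets through x add up to -1 or 0. *)
Lemma sum_stable_card g :
  (\sum_(S : {set T} | g \in 'N(S | 'P)%g) (-1) ^+ #|S| * restr_sgn S g * #|S|%:R
   = - (#|T| * full_cycle g)%:R :> int)%R.
Proof.
pose w S : int := ((-1) ^+ #|S| * restr_sgn S g)%R.
transitivity (\sum_(S | g \in 'N(S | 'P)%g) \sum_(x in S) w S)%R.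
  by apply: eq_bigr => S _; rewrite sumr_const mulr_natr.
rewrite (exchange_big_dep xpredT) //=.
transitivity (\sum_(x : T) - (full_cycle g)%:R : int)%R; last first.
  by rewrite sumr_const mulNrn natrM mulr_natl.
apply: eq_bigr => x _; have [fg|fg] := boolP (full_cycle g).
  (* Only S = T is stable and contains x; with n = #|T| its weight is (-1)^n (- (-1)^n) = -1. *)
  rewrite (bigD1 setT) /=; last first.
    by rewrite -(full_cycle_porbit x fg) astabs_porbit porbit_id.
  rewrite big1 ?addr0 => [|S /andP[/andP[gS Sx] nST]]; last first.
    have [S0|ST] := full_cycle_stable fg gS; last by rewrite ST eqxx in nST.
    by rewrite S0 inE in Sx.
  rewrite /w -(full_cycle_porbit x fg) restr_sgn_porbit mulrN -expr2 sqrr_sign //.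
(* Pair each S with its symmetric difference with an orbit B avoiding x. *)
pose C := porbit g x; have [y Cy] : exists y, y \notin C.
  apply/existsP; rewrite -negb_forall; apply: contra fg => /forallP allC.
  by apply: (@full_cycle_of_porbit _ x); apply/setP=> y; rewrite in_setT; apply: allC.
pose B := porbit g y; have Bx : x \notin B by rewrite porbit_sym.
have gB : g \in 'N(B | 'P)%g := astabs_porbit g y.
have By : y \in B := porbit_id g y.
rewrite /= oppr0 (bigID (fun S : {set T} => y \in S)) /=.
rewrite (reindex_onto (fun S => S :|: B) (fun S => S :\: B)) /=; last first.
  move=> S /andP[/andP[gS _] Sy]; rewrite -[RHS](setID S B) setUC.
  by rewrite (setIidPr (porbit_sub_astabs gS Sy)).
have disjB S : g \in 'N(S | 'P)%g -> y \notin S -> [disjoint S & B].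
  move=> gS Sy; rewrite -setI_eq0; apply/eqP/setP=> z; rewrite !inE.
  apply/negP=> /andP[Sz]; rewrite porbit_sym => Bz.
  by case/negP: Sy; apply: (subsetP (porbit_sub_astabs gS Sz)).
rewrite -[X in (X + _)%R]opprK -sumrN addrC; apply/eqP; rewrite subr_eq0; apply/eqP.
have gD S : g \in 'N(S | 'P)%g -> g \in 'N(S :\: B | 'P)%g.
  by move=> gS; apply: astabs_permP => z; rewrite !inE !astabs_perm_act.
apply: eq_big => S.
  apply/idP/idP=> [/andP[/andP[gS Sx] Sy]|].
    have /setDidPl dSB := disjB S gS Sy.
    rewrite setDUl setDv setU0 dSB eqxx !in_setU Sx By orbT !andbT.
    by apply: astabs_permP => z; rewrite !in_setU !astabs_perm_act.
  rewrite setDUl setDv setU0 !in_setU (negPf Bx) orbF.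
  move=> /andP[/andP[/andP[gSB Sx] _] /eqP dSB].
  have := gD _ gSB; rewrite setDUl setDv setU0 dSB => ->.
  by rewrite Sx -dSB in_setD By.
move=> /andP[/andP[gS Sx] Sy].
have dSB := disjB S gS Sy.
(* Adding B multiplies the weight by (-1)^#|B| (- (-1)^#|B|) = -1. *)
rewrite /w restr_sgnU // (restr_sgn_porbit g y) -/B.
have -> : #|S :|: B| = (#|S| + #|B|)%N by apply/eqP; rewrite (leq_card_setU S B).
by rewrite exprD mulrACA mulrN -expr2 sqrr_sign mulrN1 opprK.
Qed.

End FullCycles.

(** * The number of full cycles *)

Section CountFullCycles.

Variable T : finType.
Implicit Types (a c g : {perm T}) (S B : {set T}) (x y : T).

(** Multiplication by a transposition of two points of S permutes the stabilizer and reverses the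
    sign. *)
Lemma sum_restr_sgn S : 1 < #|S| ->
  (\sum_(g in 'N(S | 'P)%g) restr_sgn S g = 0)%R.
Proof.
move=> /card_gt1P[x [y [Sx Sy xy]]].
have tS : tperm x y \in 'N(S | 'P)%g.
  by apply: astabs_permP => z Sz; case: tpermP.
set s := (\sum_(_ in _) _)%R; suff : s = (- s)%R by lia.
rewrite {1}/s (reindex_inj (mulIg (tperm x y))) -sumrN /=.
apply: eq_big => g; first by rewrite groupMr.
by rewrite groupMr // => gS; rewrite restr_sgnM // restr_sgn_tperm // mulrN1.
Qed.

Lemma card_perm_fix x : #|[set g : {perm T} | g x == x]| = #|T|.-1`!.
Proof.
rewrite -[in RHS](cardsC1 x) -card_perm -[RHS]cardsE; apply: eq_card => g; rewrite !inE.
apply/eqP/subsetP=> [gx y|gx]; first by rewrite !inE; apply: contraNneq => ->; rewrite gx.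
by apply/eqP/negPn/negP=> /gx; rewrite !inE eqxx.
Qed.

(* Sum the signed identity over all g: the stable sets with at least two points
   cancel, and a singleton is stable under (#|T| - 1)! permutations. *)
Lemma card_full_cycle : 0 < #|T| -> #|[set g : {perm T} | full_cycle g]| = #|T|.-1`!.
Proof.
move=> T0; apply/eqP; rewrite -(eqn_pmul2l T0); apply/eqP.
have : (\sum_(g : {perm T})
  (\sum_(S : {set T} | g \in 'N(S | 'P)%g) (-1) ^+ #|S| * restr_sgn S g * #|S|%:R)
   = - (#|T| * #|[set g : {perm T} | full_cycle g]|)%:R :> int)%R.
  rewrite (eq_bigr _ (fun g _ => sum_stable_card g)) sumrN -natr_sum -big_distrr /=.
  congr (- (_ * _)%:R)%R; rewrite -sum1_card [RHS]big_mkcond /=.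
  by apply: eq_bigr => g _; rewrite inE; case: ifP.
rewrite (exchange_big_dep xpredT) //= => sumE.
suff : (- (#|T| * #|T|.-1`!)%:R
  = - (#|T| * #|[set g : {perm T} | full_cycle g]|)%:R :> int)%R.
  by move=> /oppr_inj /eqP; rewrite eqr_nat => /eqP.
rewrite -{}sumE (bigID (fun S : {set T} => #|S| == 1%N)) /=.
rewrite [X in (_ + X)%R]big1 => [|S S1].
  rewrite addr0 (eq_bigl (fun S => S \in [set [set x] | x in T])); last first.
    move=> S; apply/cards1P/imsetP=> [[x ->]|[x _ ->]]; by exists x.
  rewrite big_imset /=; last by move=> x y _ _; apply: set1_inj.
  rewrite (eq_bigr (fun=> - (#|T|.-1`!)%:R : int)%R) => [|x _].
    by rewrite sumr_const natrM mulNrn mulr_natl.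
  rewrite cards1 expr1 -(card_perm_fix x) -sum1_card natr_sum -sumrN.
  apply: eq_big => [g|g _]; last by rewrite restr_sgn1 mulr1.
  by rewrite astabs_permE imset_set1 inE (inj_eq set1_inj).
have [S0|S0] := posnP #|S|; first by apply: big1 => g _; rewrite S0 mulr0.
by rewrite -mulr_suml -mulr_sumr sum_restr_sgn ?mulr0 ?mul0r // ltn_neqAle eq_sym S1.
Qed.

Lemma full_cycle_iter_inj c y : full_cycle c ->
  {in gtn #|T| &, injective (fun i => iter i c y)}.
Proof.
move=> fc i k; rewrite !inE => iT kT.
have := uniq_traject_porbit c y; rewrite full_cycle_porbit // cardsT => uT e.
by apply/eqP; rewrite -(nth_uniq y _ _ uT) ?size_traject // !nth_traject // e.
Qed.

Lemma card_traject c y j : full_cycle c -> j <= #|T| -> #|[set x in traject c y j]| = j.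
Proof.
move=> fc jT; rewrite cardsE -[RHS](size_traject c y); apply/card_uniqP.
have := uniq_traject_porbit c y; rewrite full_cycle_porbit // cardsT.
by rewrite -(subnKC jT) trajectD cat_uniq => /andP[].
Qed.

End CountFullCycles.

(** * Arcs of a full cycle, and the sets that it moves by a single point *)

Section Arcs.

Variable T : finType.
Implicit Types (a c g : {perm T}) (S B : {set T}) (x y : T).

(** Serves to show that an arc or an orbit exhausts a set: the remainder is closed and misses a
    point. *)
Lemma full_cycle_closed c S x : full_cycle c ->
  (forall z, z \in S -> c z \in S) -> x \notin S -> S = set0.
Proof.
move=> fc cS nSx; have [//|ST] := full_cycle_stable fc (astabs_permP cS).
by rewrite ST in_setT in nSx.
Qed.

(** S' arises from S by trading one point for another. For a full cycle c, the sets S with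
    [near S (c @: S)] turn out to be its proper nonempty arcs. *)
Definition near S S' := (#|S'| == #|S|) && (#|S' :\: S| == 1%N).

Lemma near_imset c S : near S (c @: S) = (#|c @: S :\: S| == 1%N).
Proof. by rewrite /near card_imset ?eqxx //; apply: perm_inj. Qed.

Lemma nearC S S' : near S S' = near S' S.
Proof. by rewrite /near eq_sym; case: eqP => //= e; rewrite !cardsD setIC e. Qed.

Definition seg c j y := [set x in traject c y j].

Lemma in_seg c j y x : reflect (exists2 i, i < j & x = iter i c y) (x \in seg c j y).
Proof. by rewrite inE; apply: trajectP. Qed.

Lemma iter_card_full_cycle c y : full_cycle c -> iter #|T| c y = y.
Proof.
by move=> fc; have := iter_porbit c y; rewrite full_cycle_porbit // cardsT.
Qed.

(** The image is the arc shifted by one step; its only new point is the successor of the old end,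
    new because j < #|T|. *)
Lemma near_seg c j y : full_cycle c -> 0 < j < #|T| -> near (seg c j y) (c @: seg c j y).
Proof.
move=> fc /andP[j0 jT]; rewrite near_imset; apply/cards1P; exists (iter j c y).
apply/setP=> x; rewrite in_set1 in_setD; apply/andP/eqP=> [[nx]|->].
  case/imsetP=> z /in_seg[i ij ->] ex; rewrite ex -iterS; suff -> : i.+1 = j by [].
  move: nx; rewrite ex -iterS; apply: contraNeq => ne.
  by apply/in_seg; exists i.+1 => //; rewrite ltn_neqAle ne.
split; last first.
  case: j j0 {jT} => // j _; rewrite iterS; apply: imset_f.
  by apply/in_seg; exists j.
apply/in_seg=> -[i ij e]; have := full_cycle_iter_inj fc (ltn_trans ij jT) jT.
by move/(_ y (esym e)) => ei; rewrite ei ltnn in ij.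
Qed.

(** If y were not the start z, its predecessor would lie on the common arc, hence be reached from y
    in k < j steps, and y would recur after k + 1 < #|T| steps. *)
Lemma seg_inj c j : full_cycle c -> 0 < j < #|T| -> injective (seg c j).
Proof.
move=> fc /andP[j0 jT] y z eF.
have /in_seg[i ij ey] : y \in seg c j z.
  by rewrite -eF; apply/in_seg; exists 0%N.
case: i ij ey => // i ij ey.
have /in_seg[k kj ek] : iter i c z \in seg c j y.
  by rewrite eF; apply/in_seg; exists i => //; apply: ltnW.
have e : iter k.+1 c y = iter 0 c y by rewrite iterS -ek -iterS -ey.
have kT : k.+1 < #|T| := leq_ltn_trans kj jT.
by have := full_cycle_iter_inj fc kT (leq_ltn_trans (leq0n _) kT) e.
Qed.

(** The arc starts at the one point of S whose predecessor is not in S. *)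
Lemma near_is_seg c S : full_cycle c -> near S (c @: S) -> exists y, S = seg c #|S| y.
Proof.
move=> fc; rewrite nearC => /andP[/eqP cS /cards1P[y Sy]]; exists y.
have [yS ycS] : y \in S /\ y \notin c @: S.
  by have := set11 y; rewrite -Sy inE => /andP[].
have uniq_y z : z \in S -> z \notin c @: S -> z = y.
  by move=> Sz cz; apply/set1P; rewrite -Sy inE cz.
(* m is the first time that the orbit of y leaves S; it does leave, since the predecessor of y is
   not in S. *)
have [m nSm minm] : exists2 m, iter m c y \notin S & forall i, i < m -> iter i c y \in S.
  have ex : exists m, iter m c y \notin S.
    exists #|T|.-1; apply: contra ycS => Sz; rewrite -(iter_card_full_cycle y fc).
    have : 0 < #|T| by apply/card_gt0P; exists y.
    by case: #|T| Sz => //= k Sz _; apply: imset_f.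
  exists (ex_minn ex) => [|i]; case: ex_minnP => // m _ minm.
  by rewrite ltnNge; apply: contraNT; apply: minm.
have m0 : 0 < m by rewrite lt0n; apply: contraNneq nSm => ->.
have sub : seg c m y \subset S.
  by apply/subsetP=> _ /in_seg[i im ->]; apply: minm.
(* The rest of S is closed under c^-1: a point of S other than y has its predecessor in S, and if
   that were on the arc, the point would be on the arc too or, at step m, outside S. *)
have S0 : S :\: seg c m y = set0.
  apply: (@full_cycle_closed c^-1%g _ y); first by rewrite full_cycleV.
    move=> z; rewrite !in_setD => /andP[nz Sz].
    have : z \in c @: S.
      apply: contraR nz => /(uniq_y _ Sz) ->.
      by apply/in_seg; exists 0%N.
    case/imsetP=> s Ss ez; rewrite ez permK Ss andbT.
    apply/in_seg=> -[i im es]; move: nz; rewrite ez es -iterS.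
    have [em _|ne] := eqVneq i.+1 m.
      by move: Sz; rewrite ez es -iterS em; apply/negP.
    by case/in_seg; exists i.+1 => //; rewrite ltn_neqAle ne.
  by rewrite in_setD negb_and negbK; apply/orP; left; apply/in_seg; exists 0%N.
have eS : S = seg c m y by apply/eqP; rewrite eqEsubset sub -setD_eq0 S0 eqxx.
suff -> : #|S| = m by [].
apply/eqP; rewrite eqn_leq; apply/andP; split.
  by rewrite eS cardsE -[m in X in _ <= X](size_traject c y) card_size.
(* If #|S| < m, then S contains an arc of #|S| + 1 steps, whose points are distinct because S is
   proper. *)
rewrite leqNgt; apply/negP => ltm.
have /subset_leq_card : seg c #|S|.+1 y \subset S.
  by apply/subsetP=> _ /in_seg[i im ->]; apply: minm; apply: leq_trans ltm.
rewrite card_traject ?ltnn // cS -cardsT proper_card // properE subsetT.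
by apply/subsetPn; exists y; rewrite ?inE.
Qed.

End Arcs.

(** * Counting the full cycles that carry R to a set S near it *)

Lemma perm_of_fibers (T K : finType) (f f' : T -> K) :
  (forall k, #|[pred x | f x == k]| = #|[pred x | f' x == k]|) ->
  exists h : {perm T}, forall x, f' (h x) = f x.
Proof.
move=> eqf; pose F (u : T -> K) k := enum [pred x | u x == k].
have sF k : size (F f k) = size (F f' k) by rewrite -!cardE eqf.
have iF x : index x (F f (f x)) < size (F f (f x)).
  by rewrite index_mem mem_enum inE.
(* The fibers over [f x] are matched in the order of their enumerations; they have equal sizes, so
   the default [x] is never returned. *)
pose h x := nth x (F f' (f x)) (index x (F f (f x))).
have f'h x : f' (h x) = f x.
  have : h x \in F f' (f x) by apply: mem_nth; rewrite -sF.
  by rewrite mem_enum inE => /eqP.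
have h_inj : injective h.
  move=> x y e; have exy : f x = f y by rewrite -!f'h e.
  have : h x = h y by []; rewrite /h -exy (set_nth_default x) -?sF; last first.
    by rewrite exy.
  move/eqP; rewrite nth_uniq ?enum_uniq -?sF ?iF //; last by rewrite exy.
  by move/eqP/index_inj; apply=> //; rewrite mem_enum inE ?exy.
by exists (perm h_inj) => x; rewrite permE.
Qed.

Section CountTransports.

Variable T : finType.
Implicit Types (a c g h : {perm T}) (S R : {set T}) (x y : T).

(** These sets are the arcs of size j, one for each starting point. *)
Lemma card_near_imset c j : full_cycle c -> 0 < j < #|T| ->
  #|[set S : {set T} | (#|S| == j) && near S (c @: S)]| = #|T|.
Proof.
move=> fc jT; have -> : [set S : {set T} | (#|S| == j) && near S (c @: S)]
    = [set seg c j y | y in T].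
  apply/setP=> S; rewrite inE; apply/andP/imsetP=> [[/eqP <- nS]|[y _ ->]].
    by have [y {1}->] := near_is_seg fc nS; exists y.
  by rewrite near_seg // card_traject ?eqxx // ltnW //; case/andP: jT.
by rewrite card_imset //; apply: seg_inj.
Qed.

(** A near set is determined by the point leaving S and the point entering it, chosen
    independently. *)
Lemma card_near S : #|[set S' | near S S']| = (#|S| * (#|T| - #|S|))%N.
Proof.
have -> : (#|T| - #|S|)%N = #|~: S| by rewrite -(cardsC S) addKn.
rewrite -cardsX -(card_in_imset (f := fun u => u.2 |: S :\ u.1)).
  apply: eq_card => S'; rewrite inE; apply/idP/imsetP=> [|[[x y]]].
    move=> nS; have := nS; rewrite nearC => /andP[_ /cards1P[x Sx]].
    case/andP: nS => _ /cards1P[y Sy].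
    have := set11 x; rewrite -Sx inE => /andP[xS' xS].
    have := set11 y; rewrite -Sy inE => /andP[yS yS'].
    exists (x, y); first by rewrite !inE /= xS.
    apply/setP=> z; rewrite !inE /=.
    have := erefl (z \in S :\: S'); rewrite {1}Sx !inE.
    have := erefl (z \in S' :\: S); rewrite {1}Sy !inE => -> ->.
    by case: (z \in S); case: (z \in S').
  rewrite !inE /= => /andP[xS yS] ->; rewrite /near cardsU1 !inE (negPf yS) andbF /=.
  rewrite add1n (cardsD1 x S) xS add1n eqxx /=; apply/cards1P; exists y.
  apply/setP=> z; rewrite !inE; case: eqVneq => [->|] //=; rewrite ?yS // => _.
  by case: (z \in S); rewrite ?andbF.
move=> [x y] [x' y']; rewrite !inE /= => /andP[xS yS] /andP[xS' yS'] /setP e.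
have := e x; have := e y; rewrite !inE !eqxx (negPf yS) xS /= andbF orbF andbT.
case: eqVneq => // -> _; case: (eqVneq x y') => [exy|_]; first by rewrite -exy xS in yS'.
rewrite orbC; case: (eqVneq x y) => [exy|_] /=; first by rewrite -exy xS in yS.
by case: eqVneq => // ->.
Qed.

(** The sizes of the four cells cut out by R and S depend only on #|R|, which makes near pairs of
    that size equivalent under permutations of T. *)
Lemma card_setI_near R S : near R S ->
  [/\ #|R :&: S| = #|R|.-1, #|R :&: ~: S| = 1%N, #|~: R :&: S| = 1%N
    & #|~: R :&: ~: S| = (#|T| - #|R|.+1)%N].
Proof.
move=> nRS; have := nRS; rewrite nearC => /andP[/eqP eRS /eqP]; rewrite setDE => RS1.
have := nRS => /andP[_ /eqP]; rewrite setDE setIC => SR1.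
have RSE : #|R :&: S| = #|R|.-1 by rewrite -(cardsID S R) setDE RS1 addn1.
split=> //; rewrite -setCU cardsCs setCK; congr (_ - _)%N.
have /eqP : #|R :|: S| + #|R :&: S| = #|R| + #|S| := cardsUI R S.
rewrite RSE -eRS; have : 0 < #|R| by rewrite -(cardsID S R) setDE RS1 addn1.
by case: #|R| => // r _; rewrite addnS -addSn eqn_add2r => /eqP.
Qed.

Definition transports R S := [set a : {perm T} | full_cycle a & a @: R == S].

Lemma card_transportsJ h R S :
  #|transports (h @: R) (h @: S)| = #|transports R S|.
Proof.
rewrite -(card_imset (transports R S) (@conjg_inj _ h)); apply: eq_card => a.
apply/idP/imsetP => [|[b]]; rewrite !inE.
  move=> /andP[fa /eqP aR]; exists (a ^ h^-1)%g; last by rewrite conjgKV.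
  rewrite inE full_cycleJ fa; apply/eqP.
  apply: (imset_inj (@perm_inj _ h)); rewrite -aR -!imset_comp.
  by apply: eq_imset => x /=; rewrite -permJ conjgKV.
move=> /andP[fb /eqP <-] ->; rewrite full_cycleJ fb -!imset_comp; apply/eqP.
by apply: eq_imset => x /=; rewrite permJ.
Qed.

(** A permutation matching the four cells carries one pair to the other, and conjugation by it
    carries the transports along. *)
Lemma card_transports_near R S R' S' : #|R| = #|R'| -> near R S -> near R' S' ->
  #|transports R S| = #|transports R' S'|.
Proof.
move=> eRR' nRS nRS'.
pose f (R S : {set T}) x := (x \in R, x \in S).
have [k|h fh] := @perm_of_fibers _ _ (f R S) (f R' S').
  have fE U V b1 b2 : #|[pred x | f U V x == (b1, b2)]| =
    #|(if b1 then U else ~: U) :&: (if b2 then V else ~: V)|.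
    apply: eq_card => x; rewrite inE /f xpair_eqE in_setI.
    by case: b1; case: b2; rewrite ?inE; case: (x \in U); case: (x \in V).
  case: k => b1 b2; rewrite !fE.
  have [r1 r2 r3 r4] := card_setI_near nRS; have [r1' r2' r3' r4'] := card_setI_near nRS'.
  by case: b1; case: b2; rewrite ?r1 ?r2 ?r3 ?r4 ?r1' ?r2' ?r3' ?r4' ?eRR'.
have hE (U U' : {set T}) : (forall x, (h x \in U') = (x \in U)) -> h @: U = U'.
  move=> hU; apply/setP=> x; rewrite -[x](permKV h) mem_imset ?hU //.
  exact: perm_inj.
rewrite -(hE R R') => [|x]; last by have [] := fh x.
by rewrite -(hE S S') => [|x]; rewrite ?card_transportsJ //; have [] := fh x.
Qed.

(* The number of transports depends only on #|R|: average it over all near pairs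
   of that size, which each full cycle realises #|T| times. *)
Lemma card_transports R S : 0 < #|R| < #|T| -> near R S ->
  #|transports R S| = (#|R|.-1`! * (#|T| - #|R|).-1`!)%N.
Proof.
move=> /andP[R0 RT] nRS.
have RjT : 0 < #|R| < #|T| by rewrite R0.
have T0 : 0 < #|T| by apply: leq_ltn_trans RT.
have : (\sum_(R' : {set T} | #|R'| == #|R|) \sum_(S' | near R' S') #|transports R' S'|
  = #|T|`!)%N.
  transitivity (\sum_(a : {perm T} | full_cycle a) #|T|)%N; last first.
    rewrite sum_nat_const; have := card_full_cycle T0; rewrite cardsE => ->.
    by rewrite mulnC; case: #|T| T0.
  transitivity (\sum_(R' : {set T} | #|R'| == #|R|) \sum_(a : {perm T} | full_cycle a)
     (near R' (a @: R') : nat))%N.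
    apply: eq_bigr => R' _.
    transitivity (\sum_(S' | near R' S')
        \sum_(a : {perm T} | full_cycle a) (a @: R' == S'))%N.
      apply: eq_bigr => S' _; rewrite -sum1_card [RHS]big_mkcond [LHS]big_mkcond /=.
      by apply: eq_bigr => a _; rewrite inE; case: full_cycle => //=; case: eqP.
    rewrite exchange_big /=; apply: eq_bigr => a _.
    rewrite big_mkcond /= (bigD1 (a @: R')) //= eqxx big1 ?addn0.
      by case: near.
    by move=> S' ne; rewrite eq_sym (negPf ne); case: near.
  rewrite exchange_big /=; apply: eq_bigr => a fa.
  rewrite -[RHS](card_near_imset fa RjT) -[RHS]sum1_card.
  rewrite [RHS]big_mkcond [LHS]big_mkcond /=.
  by apply: eq_bigr => R' _; rewrite inE; case: eqP => //=; case: near.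
rewrite (eq_bigr (fun=> #|R| * (#|T| - #|R|) * #|transports R S|)%N); last first.
  move=> R' /eqP eR; rewrite -eR -card_near -sum_nat_const.
  apply: eq_big => S'; first by rewrite inE.
  by move=> nS'; apply: card_transports_near.
(* With n = #|T|, r = #|R| and N transports: C(n,r) r (n - r) N = n! = C(n,r) r! (n - r)!. The
   binomial cancels, then r (n - r). *)
rewrite sum_nat_const -cardsE card_draws -(bin_fact (ltnW RT)).
have b0 : 0 < 'C(#|T|, #|R|) by rewrite bin_gt0 ltnW.
move/eqP; rewrite eqn_pmul2l //.
case: #|R| R0 RT {b0 RjT nRS} => // r _ RT.
case: (#|T| - r.+1)%N (subn_gt0 r.+1 #|T|) => [|k _].
  by rewrite RT.
rewrite !factS /= mulnACA eqn_pmul2l ?muln_gt0 //.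
by move/eqP.
Qed.

End CountTransports.

(** * The signed sum over full cycles a, for c fixed *)

Section CountProducts.

Variable T : finType.
Implicit Types (a c g h : {perm T}) (S R : {set T}) (x y : T).

Lemma astabs_permM c a S : ((c * a)%g \in 'N(S | 'P)%g) = (a @: (c @: S) == S).
Proof.
rewrite astabs_permE -imset_comp; congr (_ == _).
by apply: eq_imset => x; rewrite permM.
Qed.

(** Let t swap two points of S outside c S. It fixes c S pointwise, so c (a ^ t) agrees with (c a) t
    on S, and conjugating a by t permutes the summands and reverses their signs. *)
Lemma sum_restr_sgn_far c S : 1 < #|S :\: c @: S| ->
  (\sum_(a | full_cycle a && ((c * a)%g \in 'N(S | 'P)%g)) restr_sgn S (c * a)%g = 0)%R.
Proof.
move=> /card_gt1P[x [y [/setDP[Sx cSx] /setDP[Sy cSy] xy]]].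
pose t := tperm x y.
have tS : t \in 'N(S | 'P)%g by apply: astabs_permP => z Sz; rewrite /t; case: tpermP.
have t_cS z : z \in S -> t (c z) = c z.
  move=> Sz; rewrite /t tpermD //.
    by apply: contraNneq cSx => ->; apply: imset_f.
  by apply: contraNneq cSy => ->; apply: imset_f.
have tt : (t^-1 = t)%g by rewrite /t tpermV.
have cat a : {in S, (c * a ^ t)%g =1 (c * a * t)%g}.
  by move=> z Sz; rewrite /conjg tt !permM t_cS.
have catS a : ((c * a ^ t)%g \in 'N(S | 'P)%g) = ((c * a)%g \in 'N(S | 'P)%g).
  apply/idP/idP=> caS; apply: astabs_permP => z Sz.
    by rewrite -(astabs_perm_act _ tS) -permM -cat // astabs_perm_act.
  by rewrite cat // permM !astabs_perm_act.
set s := (\sum_(_ | _) _)%R; suff : s = (- s)%R by lia.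
rewrite {1}/s (reindex_inj (@conjg_inj _ t)) -sumrN /=.
apply: eq_big => a; first by rewrite full_cycleJ catS.
rewrite full_cycleJ catS => /andP[_ caS].
rewrite -[RHS]mulrN1 -(restr_sgn_tperm xy Sx Sy) -restr_sgnM //.
by rewrite /restr_sgn (eq_in_restr_perm _ _ (cat a)) ?catS // groupM.
Qed.

(** The product stabilizes S because the transposition returns the one escaping point y to x. On S
    off the orbit of x it agrees with c, so the rest of S is closed under c, misses x and is
    empty. *)
Lemma porbit_mul_tperm c S x y : full_cycle c -> x \in S -> y \notin S ->
  c @: S = y |: S :\ x -> porbit (c * tperm x y)%g x = S.
Proof.
move=> fc Sx Sy cS; set g := (c * _)%g; set C := porbit g x.
have gS : g \in 'N(S | 'P)%g.
  apply: astabs_permP => z Sz; have : c z \in c @: S by apply: imset_f.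
  rewrite cS permM !inE; case: tpermP => [->|//|_ /eqP cy] //.
    by rewrite eqxx /= orbF => /eqP xy; rewrite -xy Sx in Sy.
  by rewrite (negPf cy) => /andP[].
have CS : C \subset S := porbit_sub_astabs gS Sx.
apply/eqP; rewrite eqEsubset CS -setD_eq0; apply/eqP.
apply: (full_cycle_closed (x := x) fc); last by rewrite in_setD porbit_id.
move=> z /setDP[Sz Cz].
have gz : g z \in S :\: C.
  by rewrite in_setD !astabs_perm_act // ?Sz ?Cz ?astabs_porbit.
have : c z \in c @: S by apply: imset_f.
move: gz; rewrite cS permM in_setU1 in_setD1.
case: tpermP => [->|->|/eqP cx /eqP cy gz] //.
  by rewrite in_setD (negPf Sy) andbF.
by rewrite in_setD porbit_id.
Qed.

Lemma restr_sgnV g S : g \in 'N(S | 'P)%g -> restr_sgn S g^-1%g = restr_sgn S g.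
Proof. by move=> gS; rewrite /restr_sgn morphV // odd_permV. Qed.

(* With t = (x y) exchanging S and c S, write c a = (c t)(t a): both c t and
   (t a)^-1 permute S in a single cycle, so that the two signs agree. *)
Lemma restr_sgn_near c a S : full_cycle c -> full_cycle a -> near S (c @: S) ->
  (c * a)%g \in 'N(S | 'P)%g -> restr_sgn S (c * a)%g = 1%R.
Proof.
move=> fc fa nS; rewrite astabs_permM => /eqP acS.
have := nS; rewrite nearC => /andP[_ /cards1P[x xS]].
have /andP[_ /cards1P[y yS]] := nS.
have /setDP[Sx cSx] : x \in S :\: c @: S by rewrite xS set11.
have /setDP[cSy Sy] : y \in c @: S :\: S by rewrite yS set11.
have cS : c @: S = y |: S :\ x.
  by rewrite -yS -xS setDDr setDv set0U setIC setUC setID.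
have acS' : a^-1%g @: S = c @: S.
  rewrite -{1}acS -imset_comp -[RHS]imset_id.
  by apply: eq_imset => z /=; rewrite permK.
have stab b : full_cycle b -> b @: S = c @: S ->
  (b * tperm x y)%g \in 'N(S | 'P)%g /\
  restr_sgn S (b * tperm x y)%g = (- (-1) ^+ #|S|)%R.
  move=> fb bS; have <- : porbit (b * tperm x y)%g x = S.
    by apply: porbit_mul_tperm => //; rewrite bS.
  by rewrite restr_sgn_porbit astabs_porbit.
have [ctS ct] := stab c fc erefl.
have [|atS at_] := stab a^-1%g _ acS'; first by rewrite full_cycleV.
have -> : (c * a = (c * tperm x y) * (a^-1 * tperm x y)^-1)%g.
  by rewrite invMg invgK tpermV -mulgA tpermKg.
rewrite restr_sgnM ?groupV // restr_sgnV // ct at_ mulrNN -expr2 sqrr_sign //.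
Qed.

Lemma sum_full_cycle_products c : odd #|T| -> full_cycle c ->
  ((#|[set a | full_cycle a & full_cycle (c * a)%g]|)%:R
   = #|T|.-1`!%:R - \sum_(1 <= j < #|T|) (-1) ^+ j * (j`! * (#|T| - j).-1`!)%:R :> int)%R.
Proof.
move=> oT fc; set N := #|_|; have T0 : 0 < #|T| by case: #|T| oT.
pose G S : int := (\sum_(a | full_cycle a && ((c * a)%g \in 'N(S | 'P)%g))
   restr_sgn S (c * a)%g)%R.
pose F S : int := ((-1) ^+ #|S| * #|S|%:R * G S)%R.
(* The signed identity for c a, summed over the full cycles a, with the sums exchanged. *)
have NE : (- (#|T| * N)%:R = \sum_(S : {set T}) F S :> int)%R.
  transitivity (\sum_(a | full_cycle a) - (#|T| * full_cycle (c * a)%g)%:R : int)%R.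
    rewrite sumrN -natr_sum -big_distrr /N -sum1_card /= big_mkcond [in RHS]big_mkcond /=.
    congr (- (_ * _)%:R)%R; apply: eq_bigr => a _; rewrite inE.
    by case: full_cycle => //; case: full_cycle.
  under eq_bigr => a _ do rewrite -sum_stable_card.
  rewrite (exchange_big_dep xpredT) //=; apply: eq_bigr => S _.
  by rewrite /F /G mulr_sumr; apply: eq_bigr => a _; rewrite mulrAC.
(* Every a stabilizes T, and c a is even because c and a are. *)
have GT : G setT = (#|T|.-1`!)%:R%R.
  rewrite -(card_full_cycle T0) -sum1_card natr_sum /G.
  apply: eq_big => a.
    rewrite inE; case: full_cycle => //=; rewrite astabs_permM.
    by rewrite eqEcard subsetT !card_imset ?leqnn //; apply: perm_inj.
  move=> /andP[fa _].
  by rewrite restr_sgnT odd_permM (odd_full_cycle fc) (odd_full_cycle fa) oT.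
have G1 S : near S (c @: S) -> 0 < #|S| < #|T| ->
  G S = (#|S|.-1`! * (#|T| - #|S|).-1`!)%:R%R.
  move=> nS ST; rewrite /G.
  have cST : #|c @: S| = #|S| by rewrite card_imset //; apply: perm_inj.
  transitivity ((#|transports (c @: S) S|)%:R : int)%R; last first.
    by rewrite card_transports ?cST // nearC.
  rewrite -sum1_card natr_sum.
  apply: eq_big => a; first by rewrite astabs_permM [RHS]inE.
  by case/andP=> fa caS; rewrite restr_sgn_near.
(* Either S is empty and has the factor #|S| = 0, or c S misses at least two points of S: missing
   none would make S stable under c. *)
have Gfar S : S != setT -> ~~ near S (c @: S) -> F S = 0%R.
  move=> ST; rewrite nearC; case/nandP=> [|nS].
    by rewrite card_imset ?eqxx //; apply: perm_inj.
  have [S0|/set0Pn[x Sx]] := eqVneq S set0; first by rewrite /F S0 cards0 mulr0 mul0r.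
  rewrite /F [G S]sum_restr_sgn_far ?mulr0 // ltn_neqAle eq_sym nS card_gt0 setD_eq0.
  apply: contra ST => cS; have cN : c \in 'N(S | 'P)%g.
    by rewrite astabs_permE eq_sym eqEcard cS card_imset ?leqnn //; apply: perm_inj.
  by have [S0|->//] := full_cycle_stable fc cN; rewrite S0 inE in Sx.
have nearP S : near S (c @: S) -> 0 < #|S| < #|T|.
  move=> nS; have := nS; rewrite nearC => /andP[_ /cards1P[x xS]].
  have /andP[_ /cards1P[y yS]] := nS.
  have /setDP[Sx cSx] : x \in S :\: c @: S by rewrite xS set11.
  have /setDP[cSy Sy] : y \in c @: S :\: S by rewrite yS set11.
  rewrite card_gt0; apply/andP; split; first by apply/set0Pn; exists x.
  rewrite -cardsT proper_card // properE subsetT.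
  by apply/subsetPn; exists y; rewrite ?inE.
(* The contribution of one arc of size j; the factor #|S| turns (j - 1)! into j!. *)
pose H j : int := ((-1) ^+ j * (j`! * (#|T| - j).-1`!)%:R)%R.
have FE : (\sum_(S : {set T}) F S
  = - (#|T| * #|T|.-1`!)%:R + #|T|%:R * \sum_(1 <= j < #|T|) H j)%R.
  rewrite (bigD1 setT) //=; congr (_ + _)%R.
    by rewrite /F GT cardsT -signr_odd oT expr1 mulN1r mulNr natrM.
  rewrite (bigID (fun S => near S (c @: S))) /= [X in (_ + X)%R]big1 ?addr0; last first.
    by move=> S /andP[]; apply: Gfar.
  transitivity (\sum_(1 <= j < #|T|)
    \sum_(S : {set T} | (#|S| == j) && near S (c @: S)) F S)%R.
    rewrite (exchange_big_dep (fun S : {set T} => near S (c @: S))) /=;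
      last by move=> ? ? _ /andP[].
    apply: eq_big => [S|S /andP[_ nS]].
      by apply/andb_idl => /nearP; apply: contraTneq => ->; rewrite cardsT ltnn andbF.
    rewrite nS (eq_bigl (fun j => j == #|S|)) ?big_nat1_eq ?(nearP S nS) // => j.
    by rewrite andbT eq_sym.
  rewrite mulr_sumr; apply: eq_big_nat => j jT.
  rewrite -(card_near_imset fc jT) -sum1_card natr_sum mulr_suml.
  apply: eq_big => [S|S /andP[/eqP jS nS]]; first by rewrite inE.
  rewrite mul1r /F G1 ?jS // /H -mulrA -natrM; congr (_ * _%:R)%R.
  by case: j {jS} jT => // j _; rewrite factS mulnA.
move: NE; rewrite FE => NE; apply: (mulfI (x := (#|T|)%:R%R)).
  by rewrite pnatr_eq0 -lt0n.
apply: oppr_inj; rewrite -natrM NE mulrBr opprB addrC natrM //.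
Qed.

End CountProducts.

(** * Closed form of the alternating sum and of the count *)

Lemma sum_signed_fact_prod m :
  ((m.+2)%:R * \sum_(0 <= j < m.+1) (-1) ^+ j * (j`! * (m - j)`!)%:R
   = (1 + (-1) ^+ m) * (m.+1)`!%:R :> int)%R.
Proof.
(* [f j.+1 - f j] is (-1)^j j! (m - j)! ((j + 1) + (m + 1 - j)), whose last factor is the constant m
   + 2. *)
pose f j : int := (- (-1) ^+ j * (j`! * (m.+1 - j)`!)%:R)%R.
transitivity (\sum_(0 <= j < m.+1) (f j.+1 - f j))%R; last first.
  rewrite telescope_sumr // /f subnn subn0 fact0 muln1 mul1n exprS expr0; ring.
rewrite mulr_sumr; apply: eq_big_nat => j /andP[_ jm].
rewrite /f subSS (subSn (_ : j <= m)) // !factS exprS.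
rewrite -{1}(subnKC (_ : j <= m)) // -!addnS !natrM !natrD; ring.
Qed.

Lemma card_full_cycle_products (T : finType) (c : {perm T}) :
  odd #|T| -> full_cycle c ->
  (#|T|.+1 * #|[set a | full_cycle a & full_cycle (c * a)%g]| = 2 * #|T|.-1`!)%N.
Proof.
move=> oT fc; apply/eqP; rewrite -(eqr_nat int) !natrM; apply/eqP.
rewrite sum_full_cycle_products //.
case: #|T| oT => // m om; rewrite /= in om.
set s := (\sum_(_ <= _ < _) _)%R.
have := sum_signed_fact_prod m; rewrite big_ltn // expr0 fact0 mul1n subn0 mul1r.
rewrite (_ : \sum_(1 <= j < m.+1) _ = s)%R; last first.
  by apply: eq_big_nat => j /andP[_ jm]; rewrite subSn.
rewrite -signr_odd (negPf om) expr0 factS natrM /=; move: s => s.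
rewrite -[m.+2]addn1 natrD => e.
(* Here m = #|T| - 1 is even, and m! + s is the sum from j = 0, equal to 2 (m + 1)! / (m + 2). *)
have -> : (m`!%:R - s = 2 * m`!%:R - (m`!%:R + s))%R by ring.
by rewrite mulrBr e; ring.
Qed.

(** * From pairs of full cycles to isomorphism classes of dessins *)

Section Dessins.

Variable d : nat.
Implicit Types (t u : monodromy d) (D : dessin d) (s a g : 'S_d).

Lemma full_cycle_type s : cycle_type s = [:: d] -> full_cycle s.
Proof. by move/(congr1 size); rewrite size_sort size_map -cardE => /eqP. Qed.

Lemma cycle_type_full s : full_cycle s -> cycle_type s = [:: d].
Proof.
move=> /[dup]/cards1P[C orbC] fs; rewrite /cycle_type /image_mem orbC enum_set1 /=.
have /imsetP[x _ ->] : C \in porbits s by rewrite orbC set11.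
by rewrite full_cycle_porbit // cardsT card_ord.
Qed.

Definition extremal_monodromy t :=
  [&& full_cycle (sigma0 t), full_cycle (sigma1 t) & full_cycle (sigmaoo t)].

Lemma extremal_pi t : extremal (\pi_(dessin d)%qT t) = extremal_monodromy t.
Proof.
rewrite /extremal passport_pi /monodromy_passport !xpair_eqE /extremal_monodromy andbA.
have E s : (cycle_type s == [:: d]) = full_cycle s.
  by apply/eqP/idP; [apply: full_cycle_type | apply: cycle_type_full].
by rewrite !E.
Qed.

Lemma sigmaooE t : sigmaoo t = (sigma0 t * sigma1 t)^-1%g.
Proof.
case: t => -[[s0 s1] soo] t_mon; have /andP[/eqP e _] := t_mon.
by rewrite /sigma0 /sigma1 /sigmaoo /=; apply/eqP; rewrite eq_sym eq_invg_mul e.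
Qed.

Lemma monodromy_inj t u : sigma0 t = sigma0 u -> sigma1 t = sigma1 u -> t = u.
Proof.
move=> e0 e1; have eoo : sigmaoo t = sigmaoo u by rewrite !sigmaooE e0 e1.
apply: val_inj; move: e0 e1 eoo; rewrite /sigma0 /sigma1 /sigmaoo /=.
by case: (monodromy_val t) => -[? ?] ?; case: (monodromy_val u) => -[? ?] ? /= -> -> ->.
Qed.

(** A full cycle is transitive by itself, so a is arbitrary and the third entry is forced. *)
Lemma exists_monodromy s a : full_cycle s ->
  exists t, sigma0 t = s /\ sigma1 t = a.
Proof.
move=> fs; have mon : is_monodromy (s, a, (s * a)^-1%g).
  rewrite /is_monodromy mulgV eqxx /=.
  have /cards1P[C orbC] := fs.
  have /imsetP[x _ _] : C \in porbits s by rewrite orbC set11.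
  apply/imsetP; exists x; rewrite ?inE //; apply/esym/eqP.
  rewrite -subTset -(full_cycle_porbit x fs) porbit.unlock.
  by apply: imsetS; rewrite cycle_subG mem_gen // !inE eqxx.
by exists (Monodromy mon).
Qed.

Lemma pi_eq_simconj D t :
  (\pi_(dessin d)%qT t == D) = simconj (generic_quotient.repr D) t.
Proof.
rewrite -[simconj _ _]/(simconj_equiv d _ _) eq_sym.
by apply/eqP/(eqquotP (dessin d)); rewrite reprK.
Qed.

Lemma mem_monodromy_Aut t g :
  (g \in monodromy_Aut t) = (sigma0 t ^ g == sigma0 t)%g && (sigma1 t ^ g == sigma1 t)%g.
Proof.
rewrite /monodromy_Aut cent_gen centU !cent_set1 inE.
by congr (_ && _); rewrite cent1E eq_sym conjgE -[RHS](inj_eq (mulgI g)) mulKVg.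
Qed.

(** Orbit-stabilizer: each g conjugates the representative to exactly one triple, and the g leading
    to a given triple form a coset of the automorphism group. *)
Lemma card_dessin_fiber D : extremal D ->
  (#|dessin_Aut D| * #|[set t | \pi_(dessin d)%qT t == D]|)%N = d`!.
Proof.
move=> eD; pose t := generic_quotient.repr D.
have ft : full_cycle (sigma0 t).
  by move: eD; rewrite -{1}(reprK D) extremal_pi => /and3P[].
pose conjs u := [set g | (sigma0 u == sigma0 t ^ g)%g && (sigma1 u == sigma1 t ^ g)%g].
have simE u : simconj t u = (conjs u != set0).
  apply/simconjP/set0Pn=> -[g].
    by case=> e0 e1 _; exists g; rewrite inE e0 e1 !eqxx.
  rewrite inE => /andP[/eqP e0 /eqP e1]; exists g; split=> //.
  by rewrite !sigmaooE e0 e1 conjVg conjMg.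
have card_conjs u : simconj t u -> #|conjs u| = #|dessin_Aut D|.
  rewrite simE => /set0Pn[h]; rewrite inE => /andP[/eqP e0 /eqP e1].
  rewrite -[RHS](card_rcoset _ h); apply: eq_card => g.
  rewrite mem_rcoset mem_monodromy_Aut inE e0 e1 -/t !conjgM.
  have E (p q : 'S_d) : (p ^ h^-1 == q)%g = (q ^ h == p)%g.
    by rewrite -(inj_eq (@conjg_inj _ h)) conjgKV eq_sym.
  by rewrite !E.
have -> : d`! = \sum_(g : 'S_d) 1%N.
  by rewrite sum1_card card_Sn.
transitivity (\sum_(u | simconj t u) \sum_(g in conjs u) 1)%N.
  rewrite (eq_bigr (fun=> #|dessin_Aut D|)) => [|u tu];
    last by rewrite sum1_card card_conjs.
  have -> : [set u | \pi_(dessin d)%qT u == D] = [set u | simconj t u].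
    by apply/setP=> u; rewrite !inE pi_eq_simconj.
  by rewrite sum_nat_const mulnC cardsE.
rewrite (exchange_big_dep xpredT) //=; apply: eq_bigr => g _.
have fg : full_cycle (sigma0 t ^ g)%g by rewrite full_cycleJ.
have [u [u0 u1]] := exists_monodromy (sigma1 t ^ g)%g fg.
rewrite (big_pred1 u) // => v /=; rewrite simE inE.
apply/andP/eqP=> [[_ /andP[/eqP v0 /eqP v1]]|->].
  by apply: monodromy_inj; rewrite ?u0 ?u1.
by rewrite u0 u1 !eqxx; split=> //; apply/set0Pn; exists g; rewrite inE u0 u1 !eqxx.
Qed.

(** Triples correspond to pairs of full cycles with full product: (d - 1)! choices of the first,
    then the product count for the second. *)
Lemma card_extremal_monodromy : odd d ->
  (d.+1 * #|[set t | extremal_monodromy t]| = 2 * d.-1`! * d.-1`!)%N.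
Proof.
move=> od; pose f t := (sigma0 t, sigma1 t).
have f_inj : injective f by move=> t u [e0 e1]; apply: monodromy_inj.
rewrite -(card_imset _ f_inj) -sum1_card.
transitivity (d.+1 * \sum_(s : 'S_d | full_cycle s)
  #|[set a | full_cycle a & full_cycle (s * a)%g]|)%N.
  congr (_ * _)%N; rewrite (eq_bigr (fun s : 'S_d =>
    \sum_(a : 'S_d | full_cycle a && full_cycle (s * a)%g) 1)%N); last first.
    by move=> s _; rewrite sum1_card cardsE.
  rewrite pair_big_dep /=; apply: eq_bigl => -[s a] /=.
  apply/imsetP/and3P=> [[t]|[fs fa fsa]].
    rewrite inE => /and3P[f0 f1 foo] [-> ->]; rewrite f0 f1 -full_cycleV -sigmaooE //.
  have [t [e0 e1]] := exists_monodromy a fs; exists t; last by rewrite /f e0 e1.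
  by rewrite inE /extremal_monodromy sigmaooE full_cycleV e0 e1 fs fa.
rewrite big_distrr /= (eq_bigr (fun=> 2 * d.-1`!)%N) => [|s fs].
  have d0 : 0 < #|'I_d| by rewrite card_ord; case: (d) od.
  rewrite sum_nat_const; have := card_full_cycle d0.
  by rewrite cardsE card_ord mulnC => ->.
by have := card_full_cycle_products _ fs; rewrite card_ord; apply.
Qed.

End Dessins.

Theorem theorem8p8 (d : nat) :
  ((3 <= d)%N -> odd d ->
    \sum_(D : dessin d | extremal D) (#|dessin_Aut D|%:R)^-1
      = (2 * (d - 1)`!)%:R / (d * (d + 1))%:R :> rat)%R
  /\ (~~ odd d -> [set D : dessin d | extremal D] = set0).
Proof.
split=> [d3 od|ed]; last first.
  (* For even d full cycles are odd, but the third entry, inverse to a product of two odd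
     permutations, is even. *)
  apply/setP=> D; rewrite !inE -(reprK D) extremal_pi; apply/and3P=> -[f0 f1 foo].
  have := odd_full_cycle foo; rewrite sigmaooE odd_permV odd_permM.
  by rewrite (odd_full_cycle f0) (odd_full_cycle f1) card_ord ed.
(* The d! / |Aut(D)| triples of the class D, each weighted 1 / d!, account for 1 / |Aut(D)|. *)
transitivity (\sum_(t | @extremal_monodromy d t) (d`!%:R)^-1 : rat)%R.
  rewrite (partition_big \pi_(dessin d)%qT (@extremal d)) /=; last first.
    by move=> t; rewrite extremal_pi.
  apply: eq_bigr => D eD; have FD := card_dessin_fiber eD.
  set m := #|[set t | _]| in FD.
  have m0 : (m%:R != 0 :> rat)%R.
    by rewrite pnatr_eq0 -lt0n; have := fact_gt0 d; rewrite -FD muln_gt0 => /andP[].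
  rewrite (eq_bigl (fun t => t \in [set t | \pi_(dessin d)%qT t == D])) => [|t].
    by rewrite sumr_const -/m -FD -[RHS]mulr_natr natrM invfM divfK.
  by rewrite in_set; apply: andb_idl => /eqP pt; rewrite -extremal_pi pt.
have := card_extremal_monodromy od; set k := #|_| => kE.
(* Cross-multiplied, the claim becomes d times the equality [kE]. *)
have dE : d`! = (d * (d - 1)`!)%N by case: (d) d3 => // n _; rewrite subn1 factS.
rewrite (eq_bigl (fun t => t \in [set t | extremal_monodromy t])) => [|t];
  last by rewrite in_set.
rewrite sumr_const -/k -[LHS]mulr_natr [LHS]mulrC; apply/eqP.
rewrite eqr_div // -?natrM ?pnatr_eq0 -?lt0n ?muln_gt0 ?fact_gt0 ?addn1 ?(ltnW (ltnW d3)) //.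
by rewrite eqr_nat dE mulnC -mulnA kE subn1 [X in _ == X]mulnCA.
Qed.
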